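(* Let $d\ge 2$, let $E_\mu=\mathbb{R}^{n_\mu}$ with the standard inner product for $\mu\in\{1,\dots,d\}$, and let $\mathbf{X}\in E_1\otimes\dots\otimes E_d$. Let $(U_\mu)_{\mu}$, $U_\mu\in\mathbb{R}^{n_\mu\times r_\mu}$, be the HOSVD basis and $\mathbf{C}$ the HOSVD core of $\mathbf{X}$ at multilinear rank $\mathbf{r}=(r_1,\dots,r_d)$, so that $\mathbf{X}$ is expressed as $$\mathbf{X}=\sum_{i_1=1}^{r_1}\dots\sum_{i_d=1}^{r_d}C_{i_1\dots i_d}\,\mathbf{u}^1_{i_1}\otimes\dots\otimes\mathbf{u}^d_{i_d}.$$ Let $\Sigma_\mu$ be the diagonal matrix of singular values of $X^{(\mu)}$ associated with the columns of $U_\mu$, and let $Y_\mu=U_\mu\Sigma_\mu$ be the principal components of mode $\mu$. If $r_\mu\le\operatorname{rank}(X^{(\mu)})$ for all $\mu\in\{1,\dots,d\}$, then for every $\mu\in\{1,\dots,d\}$ $$Y_\mu=X^{(\mu)}\,(Y_d\otimes_K\dots\otimes_K Y_{\mu+1}\otimes_K Y_{\mu-1}\otimes_K\dots\otimes_K Y_1)\,(B^{(\mu)})^{T},$$ where $\mathbf{B}=(\Sigma_1^{-1},\dots,\Sigma_d^{-1})\mathbf{C}$.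
   Context: For a tensor $\mathbf{A}\in\mathbb{R}^{n_1\times\dots\times n_d}$, the matricization $A^{(\mu)}$ with respect to mode $\mu$ is the matrix with $n_\mu$ rows and $\prod_{\alpha\neq\mu}n_\alpha$ columns whose entry in row $i_\mu$ and column $\overline{i_1,\dots,i_{\mu-1},i_{\mu+1},\dots,i_d}=1+\sum_{\alpha\ne\mu}(i_\alpha-1)m_\alpha$, with $m_\alpha=\prod_{\beta<\alpha,\ \beta\neq\mu}n_\beta$, is $A_{i_1\dots i_d}$. $\otimes_K$ is the Kronecker product of matrices. For matrices $M_\mu$ of compatible size, $(M_1,\dots,M_d)\mathbf{A}$ is the tensor-times-matrix product: $(M_1,\dots,M_d)(\mathbf{a}_1\otimes\dots\otimes\mathbf{a}_d)=M_1\mathbf{a}_1\otimes\dots\otimes M_d\mathbf{a}_d$, extended linearly. HOSVD of $\mathbf{X}$ at multilinear rank $\mathbf{r}$: for each mode $\mu$, the matrix $U_\mu\in\mathbb{R}^{n_\mu\times r_\mu}$ has as its columns $\mathbf{u}^\mu_1,\dots,\mathbf{u}^\mu_{r_\mu}$ orthonormal left singular vectors of $X^{(\mu)}$ associated with its $r_\mu$ largest singular values $\sigma^{(\mu)}_1\ge\dots\ge\sigma^{(\mu)}_{r_\mu}$; $\Sigma_\mu=\operatorname{diag}(\sigma^{(\mu)}_1,\dots,\sigma^{(\mu)}_{r_\mu})$; and the core is $\mathbf{C}=(U_1^{T},\dots,U_d^{T})\mathbf{X}\in\mathbb{R}^{r_1\times\dots\times r_d}$. *)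

(* Defs.v *)
From HB Require Import structures.
From mathcomp Require Import all_boot all_order all_algebra.
From mathcomp Require Import mxtens.
From mathcomp Require Import reals.

Set Implicit Arguments.
Unset Strict Implicit.
Unset Printing Implicit Defensive.

Import Order.TTheory GRing.Theory Num.Theory.
Local Open Scope ring_scope.

(* Modes and indices are numbered from 0. *)
Definition multi_index d (n : 'I_d -> nat) := {dffun forall a : 'I_d, 'I_(n a)}.

(* [R^o] provides the vector space structure of the function space. *)
Definition tensor (R : realType) d (n : 'I_d -> nat) :=
  {ffun multi_index n -> R^o}.

Section Tensor.
Variables (R : realType) (d : nat).
Implicit Types n p : 'I_d -> nat.

Definition pure_tensor n (v : forall a, 'cV[R]_(n a)) : tensor R n :=
  [ffun i : multi_index n => \prod_a v a (i a) 0].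

(* Linear extension, from the canonical basis, of the product on pure tensors:
   [ttm_pure] and [ttm_linear] characterise it. *)
Definition ttm n p (M : forall a, 'M[R]_(p a, n a)) (A : tensor R n) :
    tensor R p :=
  \sum_(i : multi_index n)
     A i *: pure_tensor (fun a => M a *m delta_mx (i a) 0).

Definition stride n (mu a : 'I_d) : nat :=
  \prod_(b < d | (b < a)%N && (b != mu)) n b.

Lemma big_mode_ltS T (idx : T) (op : Monoid.com_law idx) (F : 'I_d -> T) (mu o : 'I_d) :
  \big[op/idx]_(a < d | (a < o.+1)%N && (a != mu)) F a =
  let x := \big[op/idx]_(a < d | (a < o)%N && (a != mu)) F a in
  if o == mu then x else op (F o) x.
Proof.
rewrite /=; case: ifPn => [/eqP omu|omu].
  apply: eq_bigl => a.
  by rewrite ltnS leq_eqVlt -omu -(val_eqE a o) /=; case: ltngtP.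
rewrite (bigD1 o) /= ?ltnS ?leqnn //; congr (op _ _); apply: eq_bigl => a.
by rewrite ltnS leq_eqVlt -(val_eqE a o) /=;
  case: ltngtP; rewrite ?andbT ?andbF.
Qed.

Lemma partial_index_lt n mu (i : multi_index n) k : (k <= d)%N ->
  (\sum_(a < d | (a < k) && (a != mu)) i a * stride n mu a
     < \prod_(a < d | (a < k) && (a != mu)) n a)%N.
Proof.
elim: k => [_|k IH ltkd]; first by rewrite !big_pred0.
have {IH} := IH (ltnW ltkd); rewrite !(@big_mode_ltS _ _ _ _ mu (Ordinal ltkd)) /=.
case: ifP => // _; rewrite -/(stride n mu (Ordinal ltkd)) /= => ltSP.
apply: (@leq_trans ((i (Ordinal ltkd)).+1 * stride n mu (Ordinal ltkd))%N).
  by rewrite mulSn addnC -addSn leq_add2r.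
by rewrite leq_mul2r ltn_ord orbT.
Qed.

Lemma col_index_subproof n mu (i : multi_index n) :
  (\sum_(a < d | a != mu) i a * stride n mu a < \prod_(a < d | a != mu) n a)%N.
Proof.
have E a : (a != mu) = (a < d)%N && (a != mu) by rewrite ltn_ord.
by rewrite !(eq_bigl _ _ E) partial_index_lt.
Qed.

Definition col_index n mu (i : multi_index n) :
    'I_(\prod_(a < d | a != mu) n a) :=
  Ordinal (col_index_subproof mu i).

(* Exactly one multi-index contributes to each entry, see [matricizeE] and
   [matricize_index_bij]. *)
Definition matricize n mu (A : tensor R n) :
    'M[R]_(n mu, \prod_(a < d | a != mu) n a) :=
  \matrix_(k, l) \sum_(i : multi_index n | (i mu == k) && (col_index mu i == l)) A i.

Lemma matricize_index_inj n mu :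
  injective (fun i : multi_index n => (i mu, col_index mu i)).
Proof.
move=> i j /= [Emu Ecol].
suff H k : (k <= d)%N ->
  (\sum_(a < d | (a < k) && (a != mu)) i a * stride n mu a =
   \sum_(a < d | (a < k) && (a != mu)) j a * stride n mu a)%N ->
  forall a : 'I_d, (a < k)%N -> i a = j a.
  have E (b : 'I_d) : (b < d)%N && (b != mu) = (b != mu) by rewrite ltn_ord.
  by apply/ffunP => a; apply: (H d); rewrite // !(eq_bigl _ _ E).
elim: k => // k IH ltkd; have {}IH := IH (ltnW ltkd); pose o := Ordinal ltkd.
have [bi bj] := (partial_index_lt mu i (ltnW ltkd),
                 partial_index_lt mu j (ltnW ltkd)).
rewrite !(@big_mode_ltS _ _ _ _ mu o) /=; case: ifP => [/eqP omu /IH Hk a|_ eqij].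
  rewrite ltnS leq_eqVlt => /orP[/eqP ak|]; last exact: Hk.
  by have -> : a = mu by rewrite -omu; apply: val_inj.
have Eo : i o = j o.
  apply: val_inj; have := congr1 (divn^~ (stride n mu o)) eqij.
  rewrite /= !divnMDl ?(leq_ltn_trans _ bi) //.
  by rewrite (divn_small bi) (divn_small bj) !addn0.
move: eqij; rewrite Eo => /addnI /IH Hk a.
rewrite ltnS leq_eqVlt => /orP[/eqP ak|]; last exact: Hk.
by have -> : a = o by apply: val_inj.
Qed.

Lemma matricizeE n mu (A : tensor R n) (i : multi_index n) :
  matricize mu A (i mu) (col_index mu i) = A i.
Proof.
rewrite mxE (bigD1 i) ?eqxx //= big1 ?addr0 // => j.
case/andP=> /andP[/eqP E1 /eqP E2] /eqP[].
by apply: (@matricize_index_inj n mu); rewrite E1 E2.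
Qed.

Lemma matricize_index_bij n mu :
  bijective (fun i : multi_index n => (i mu, col_index mu i)).
Proof.
apply: inj_card_bij; first exact: matricize_index_inj.
rewrite card_prod !card_ord card_dep_ffun foldrE big_map big_enum /=.
by rewrite [X in (_ <= X)%N](bigD1 mu) //= card_ord;
  under [X in (_ <= _ * X)%N]eq_bigr => a _ do rewrite card_ord.
Qed.

Definition kron_dim (n : 'I_d -> nat) (s : seq 'I_d) : nat :=
  foldr (fun a k => (n a * k)%N) 1%N s.

(* The empty product is the 1 x 1 identity, so a nonempty chain ends with the
   neutral factor 1%:M. *)
Fixpoint kron_seq n p (M : forall a, 'M[R]_(n a, p a)) (s : seq 'I_d) :
    'M[R]_(kron_dim n s, kron_dim p s) :=
  match s with
  | [::] => 1%:M
  | a :: s' => M a *t kron_seq M s'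
  end.

(* The highest mode comes first: [*t] lets the index of its last factor vary
   fastest, and in [col_index] the lowest mode varies fastest. *)
Definition other_modes (mu : 'I_d) : seq 'I_d :=
  rev [seq a <- enum 'I_d | a != mu].

Lemma kron_dimE n mu :
  kron_dim n (other_modes mu) = (\prod_(a < d | a != mu) n a)%N.
Proof.
transitivity (\prod_(a <- other_modes mu) n a)%N.
  by elim: (other_modes mu) => [|a s IH]; rewrite ?big_nil ?big_cons //= IH.
by rewrite /other_modes bigop.big_rev big_filter big_enum_cond.
Qed.

Definition kron_other n p (M : forall a, 'M[R]_(n a, p a)) (mu : 'I_d) :
    'M[R]_(\prod_(a < d | a != mu) n a, \prod_(a < d | a != mu) p a) :=
  castmx (kron_dimE n mu, kron_dimE p mu) (kron_seq M (other_modes mu)).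

Lemma prod_sum_multi_index n (F : forall a : 'I_d, 'I_(n a) -> R) :
  \prod_a \sum_(k < n a) F a k = \sum_(i : multi_index n) \prod_a F a (i a).
Proof.
pose P (a : 'I_d) : {ffun 'I_(n a) -> R} := [ffun k => F a k].
transitivity (\prod_a \sum_(k < n a) P a k).
  by apply: eq_bigr => a _; apply: eq_bigr => k _; rewrite ffunE.
under eq_bigr => a _ do rewrite (big_tag P a).
rewrite bigA_distr_big_dep -big_fprod (reindex (@fprod_of_dffun _ _)) /=.
  apply: eq_bigr => i _; apply: eq_bigr => a _.
  by rewrite ffunE fprodE.
exact/onW_bij/fprod_of_dffun_bij.
Qed.

Lemma ttm_linear n p (M : forall a, 'M[R]_(p a, n a)) : linear (ttm M).
Proof.
move=> c A B; rewrite /ttm scaler_sumr -big_split /=; apply: eq_bigr => i _.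
by rewrite !ffunE scalerDl scalerA.
Qed.

Lemma ttm_pure n p (M : forall a, 'M[R]_(p a, n a)) v :
  ttm M (pure_tensor v) = pure_tensor (fun a => M a *m v a).
Proof.
apply/ffunP => j; rewrite /ttm sum_ffunE ffunE.
under [RHS]eq_bigr => a _ do rewrite mxE.
rewrite prod_sum_multi_index; apply: eq_bigr => i _.
rewrite !ffunE /= /GRing.scale /= -big_split /=; apply: eq_bigr => a _.
by rewrite mulrC -colE mxE.
Qed.

End Tensor.

Section SingularValues.
Variables (R : realType) (m n : nat).

(* The min(m,n) singular values, with multiplicity and in nonincreasing order,
   read off a full singular value decomposition A = P S Q^T. *)
Definition is_singular_values (A : 'M[R]_(m, n)) (s : seq R) : Prop :=
  [/\ size s = minn m n, sorted >=%R s, all (fun x => 0 <= x) s &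
   exists P : 'M[R]_m, exists Q : 'M[R]_n,
     [/\ P^T *m P = 1%:M, Q^T *m Q = 1%:M &
      A = P *m (\matrix_(i, j) (if i == j :> nat then s`_i else 0)) *m Q^T]].

Definition is_left_singular_vector (A : 'M[R]_(m, n)) (s : R) (u : 'cV[R]_m) :
    Prop :=
  u^T *m u = 1%:M /\
  exists v : 'cV[R]_n, [/\ v^T *m v = 1%:M, A *m v = s *: u & A^T *m u = s *: v].

Definition leading_left_singular r (A : 'M[R]_(m, n))
    (U : 'M[R]_(m, r)) (sigma : 'rV[R]_r) : Prop :=
  [/\ U^T *m U = 1%:M,
      forall k, is_left_singular_vector A (sigma 0 k) (col k U) &
      exists s, [/\ is_singular_values A s, (r <= size s)%N &
                    forall k : 'I_r, sigma 0 k = s`_k]].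

End SingularValues.

Section HOSVD.
Variables (R : realType) (d : nat) (n r : 'I_d -> nat).

Definition is_hosvd (X : tensor R n) (U : forall mu, 'M[R]_(n mu, r mu))
    (sigma : forall mu, 'rV[R]_(r mu)) : Prop :=
  forall mu, leading_left_singular (matricize mu X) (U mu) (sigma mu).

Definition hosvd_core (X : tensor R n) (U : forall mu, 'M[R]_(n mu, r mu)) :
    tensor R r :=
  ttm (fun mu => (U mu)^T) X.

End HOSVD.

(* Main.v *)
Require Import Defs.
From mathcomp Require Import all_boot all_order all_algebra.
From mathcomp Require Import reals mxtens.

Set Implicit Arguments.
Unset Strict Implicit.
Unset Printing Implicit Defensive.

Import Order.TTheory GRing.Theory Num.Theory.
Local Open Scope ring_scope.

(** Write X_mu, C_mu, B_mu for the matricizations in mode mu, S_a for the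
    diagonal matrix of singular values of mode a, and K(M) for the Kronecker
    product of the matrices M_a over the modes a other than mu.  Two facts about
    matricization carry the proof: K is multiplicative ([kron_otherM]), and
    applying matrices to a tensor gives (M A)_mu = M_mu A_mu K(M)^T
    ([matricize_ttm]).

    The second fact turns B = (S_1^-1, ..., S_d^-1) C into
    B_mu^T = K(S^-1) C_mu^T S_mu^-1, and the first gives
    K(Y) K(S^-1) = K(Y S^-1) = K(U).  Hence the right-hand side of the claim is
    X_mu K(U) C_mu^T S_mu^-1.  The expansion of X says that X = (U_1, ..., U_d) C,
    so X_mu = U_mu C_mu K(U)^T, and U_mu^T U_mu = 1 yields
    C_mu K(U)^T = U_mu^T X_mu, that is, K(U) C_mu^T = X_mu^T U_mu.  What remains
    is X_mu X_mu^T U_mu S_mu^-1, and X_mu X_mu^T U_mu = U_mu S_mu^2 because the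
    columns of U_mu are singular vectors ([gram_singular_vectors]).

    The rank hypothesis is what makes the S_a invertible: the r_a largest
    singular values of X_a are nonzero ([singular_value_neq0]). *)

Section Kron.
Variables (R : realType) (d : nat).
Implicit Types (n p q : 'I_d -> nat) (mu : 'I_d) (s : seq 'I_d).

(** The row of [kron_seq M s] at which the factor of each mode [a] in [s] is
    read in its row [i a]; the same position also indexes columns. *)
Fixpoint kron_index n (i : multi_index n) s : 'I_(kron_dim n s) :=
  match s with
  | [::] => ord0
  | a :: s' => mxtens_index (i a, kron_index i s')
  end.

Lemma kron_seqE n p (M : forall a, 'M[R]_(n a, p a)) s
    (i : multi_index n) (j : multi_index p) :
  kron_seq M s (kron_index i s) (kron_index j s) = \prod_(a <- s) M a (i a) (j a).
Proof.
elim: s => [|a s IH]; first by rewrite big_nil mxE eqxx.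
by rewrite big_cons /= tensmxE IH.
Qed.

Lemma other_modes_decreasing mu :
  sorted (fun a b : 'I_d => (b < a)%N) (other_modes mu).
Proof.
rewrite rev_sorted sorted_filter; first by [].
  by move=> b a c; apply: ltn_trans.
by rewrite -(@sorted_map _ _ (val : 'I_d -> nat) ltn) val_enum_ord iota_ltn_sorted.
Qed.

Lemma big_other_modes T (idx : T) (op : Monoid.com_law idx) (P : pred 'I_d)
    (F : 'I_d -> T) mu :
  \big[op/idx]_(a <- other_modes mu | P a) F a
    = \big[op/idx]_(a | P a && (a != mu)) F a.
Proof.
rewrite /other_modes bigop.big_rev big_filter_cond big_enum_cond.
by apply: eq_bigl => a; rewrite inE /= andbC.
Qed.

Lemma kron_dim_prod n s : kron_dim n s = (\prod_(a <- s) n a)%N.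
Proof. by elim: s => [|a s IH]; rewrite ?big_nil ?big_cons //= IH. Qed.

(** In a Kronecker product the index of a factor is weighted by the product of
    the dimensions of the factors on its right.  When modes decrease from left
    to right, these are the factors of lower mode, which is how [stride] is
    defined. *)
Lemma val_kron_index n (i : multi_index n) s :
  sorted (fun a b : 'I_d => (b < a)%N) s ->
  (kron_index i s = \sum_(a <- s) i a * \prod_(b <- s | (b < a)%N) n b :> nat)%N.
Proof.
elim: s => [|a s IH] s_sorted; first by rewrite big_nil.
have all_lt_a : all (fun b : 'I_d => (b < a)%N) s.
  by apply: order_path_min s_sorted => b c e cb eb; apply: ltn_trans eb cb.
rewrite /= IH ?(path_sorted s_sorted) // big_cons; congr (_ * _ + _)%N.
  rewrite big_cons ltnn -big_filter (all_filterP all_lt_a).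
  by rewrite kron_dim_prod.
have s_lt_a := allP all_lt_a.
rewrite [LHS]big_seq [RHS]big_seq; apply: eq_bigr => b /s_lt_a lt_ba.
by rewrite big_cons ltnNge (ltnW lt_ba).
Qed.

Lemma kron_index_other_modes n mu (i : multi_index n) :
  kron_index i (other_modes mu) = col_index mu i :> nat.
Proof.
rewrite val_kron_index ?other_modes_decreasing // big_other_modes /=.
by apply: eq_bigr => a _; rewrite big_other_modes.
Qed.

(** Kronecker products order their rows and columns as matricization orders its
    columns, so the entries of [kron_other] can be read at multi-indices. *)
Lemma kron_otherE n p (M : forall a, 'M[R]_(n a, p a)) mu
    (i : multi_index n) (j : multi_index p) :
  kron_other M mu (col_index mu i) (col_index mu j)
    = \prod_(a | a != mu) M a (i a) (j a).
Proof.
rewrite -[RHS](big_other_modes _ xpredT) -kron_seqE castmxE.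
by congr (kron_seq M _ _ _); apply: val_inj; rewrite /= kron_index_other_modes.
Qed.

Lemma kron_seqM n p q (M : forall a, 'M[R]_(n a, p a))
    (N : forall a, 'M[R]_(p a, q a)) s :
  kron_seq (fun a => M a *m N a) s = kron_seq M s *m kron_seq N s.
Proof. by elim: s => [|a s IH] /=; rewrite ?mulmx1 // IH tensmx_mul. Qed.

Lemma eq_kron_seq n p (M N : forall a, 'M[R]_(n a, p a)) s :
  (forall a, M a = N a) -> kron_seq M s = kron_seq N s.
Proof. by move=> MN; elim: s => //= a s ->; rewrite MN. Qed.

Lemma kron_otherM n p q (M : forall a, 'M[R]_(n a, p a))
    (N : forall a, 'M[R]_(p a, q a)) mu :
  kron_other (fun a => M a *m N a) mu = kron_other M mu *m kron_other N mu.
Proof.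
rewrite /kron_other kron_seqM.
by case: _ / (kron_dimE n mu); case: _ / (kron_dimE p mu);
  case: _ / (kron_dimE q mu).
Qed.

Lemma ttmE n p (M : forall a, 'M[R]_(p a, n a)) (A : tensor R n)
    (i : multi_index p) :
  ttm M A i = \sum_(j : multi_index n) A j * \prod_a M a (i a) (j a).
Proof.
rewrite sum_ffunE; apply: eq_bigr => j _; rewrite !ffunE; congr (_ * _).
by apply: eq_bigr => a _; rewrite -colE mxE.
Qed.

(** An entry of the transformed tensor is a sum over multi-indices of [A]; the
    bijection between multi-indices and positions in the matricization turns it
    into the double sum of a matrix product, where the factor of mode [mu] of
    the weight comes from [M mu] and the others from [kron_other]. *)
Lemma matricize_ttm n p (M : forall a, 'M[R]_(p a, n a)) (A : tensor R n) mu :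
  matricize mu (ttm M A) = M mu *m matricize mu A *m (kron_other M mu)^T.
Proof.
apply/matrixP => k l.
have [index _ /(_ (k, l))] := matricize_index_bij p mu.
move: (index _) => i [<- <-]; rewrite matricizeE ttmE mxE.
under [RHS]eq_bigr => l' _ do rewrite mxE mulr_suml.
rewrite exchange_big pair_bigA /=.
rewrite (reindex _ (onW_bij _ (matricize_index_bij n mu))) /=.
apply: eq_bigr => j _.
rewrite matricizeE mxE kron_otherE (bigD1 mu) //= mulrA; congr (_ * _).
exact: mulrC.
Qed.

End Kron.

(** If the singular value of index [k] vanished, so would all later ones, and the
    diagonal factor of the decomposition would have at most [k] nonzero rows. *)
Lemma singular_value_neq0 (R : realType) m n (A : 'M[R]_(m, n)) s k :
  is_singular_values A s -> (k < \rank A)%N -> s`_k != 0.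
Proof.
case=> _ s_sorted /allP s_ge0 [P [Q [_ _ ->]]]; set S := \matrix_(i, j) _.
move=> k_lt; apply/eqP=> sk0.
have tail0 i : (k <= i)%N -> s`_i = 0.
  move=> le_ki; case: (ltnP i (size s)) => [lt_is|]; last exact: nth_default.
  apply/eqP; rewrite eq_le s_ge0 ?mem_nth // andbT -[leRHS]sk0.
  have ge_trans : transitive (>=%R : rel R).
    by move=> y x z xy yz; apply: (le_trans yz xy).
  have := @sorted_leq_nth R >=%R ge_trans (@lexx _ R) 0 s s_sorted k i.
  by rewrite !inE /=; apply=> //; apply: leq_ltn_trans lt_is.
have S_head : S = pid_mx k *m S.
  apply/matrixP=> i j; rewrite [RHS]mxE (bigD1 i) //= big1 => [|l l_ne_i].
    rewrite !mxE eqxx /=; case: (ltnP i k) => [_|/tail0 si0].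
      by rewrite mul1r addr0.
    by rewrite si0 mul0r addr0; case: eqP.
  by rewrite !mxE [(i == l :> nat)]eq_sym (inj_eq val_inj) (negPf l_ne_i) mul0r.
have rank_le : (\rank (P *m S *m Q^T) <= \rank (pid_mx k : 'M[R]_m))%N.
  rewrite (leq_trans (mxrankM_maxl _ _)) // (leq_trans (mxrankM_maxr _ _)) //.
  by rewrite {1}S_head mxrankM_maxl.
have k_le_m : (k <= m)%N by exact: leq_trans (ltnW k_lt) (rank_leq_row _).
by move: k_lt; rewrite ltnNge (leq_trans rank_le) // rank_pid_mx.
Qed.

Lemma diag_mx_unit (F : fieldType) r (v : 'rV[F]_r) :
  (forall k, v 0 k != 0) -> diag_mx v \in unitmx.
Proof.
by move=> v_neq0; rewrite unitmxE det_diag unitfE prodf_seq_neq0; apply/allP=> k _ /=.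
Qed.

(** A left singular vector is an eigenvector of [A *m A^T] for the square of its
    singular value: [A^T] sends it to a multiple of the right singular vector,
    and [A] sends that one back. *)
Lemma gram_singular_vectors (R : realType) m n r (A : 'M[R]_(m, n))
    (U : 'M[R]_(m, r)) (sigma : 'rV[R]_r) :
  (forall k, is_left_singular_vector A (sigma 0 k) (col k U)) ->
  A *m (A^T *m U) = U *m diag_mx sigma *m diag_mx sigma.
Proof.
move=> hU; apply/trmx_inj/row_matrixP => k; rewrite -!tr_col; congr (_^T).
have [_ [v [_ Av Atu]]] := hU k.
have -> : col k (A *m (A^T *m U)) = A *m (A^T *m col k U).
  by rewrite !colE !mulmxA.
rewrite Atu -scalemxAr Av.
by apply/colP => i; rewrite !mul_mx_diag !mxE mulrC [_ * U i k]mulrC.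
Qed.

Lemma leading_singular_values_unit (R : realType) m n r (A : 'M[R]_(m, n))
    (U : 'M[R]_(m, r)) (sigma : 'rV[R]_r) :
  leading_left_singular A U sigma -> (r <= \rank A)%N ->
  diag_mx sigma \in unitmx.
Proof.
case=> _ _ [s [s_sv _ sigmaE]] le_r_rank; apply: diag_mx_unit => k.
by rewrite sigmaE (singular_value_neq0 s_sv) // (leq_trans _ le_r_rank).
Qed.

Theorem proposition2 (R : realType) (d : nat) (hd : (2 <= d)%N)
    (n r : 'I_d -> nat) (X : tensor R n)
    (U : forall mu : 'I_d, 'M[R]_(n mu, r mu))
    (sigma : forall mu : 'I_d, 'rV[R]_(r mu))
    (hU : is_hosvd X U sigma)
    (hX : X = \sum_(i : multi_index r)
                hosvd_core X U i *: pure_tensor (fun mu => col (i mu) (U mu)))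
    (hr : forall mu : 'I_d, (r mu <= \rank (matricize mu X))%N) :
  let C := hosvd_core X U in
  let Sigma := fun mu : 'I_d => diag_mx (sigma mu) in
  let Y := fun mu : 'I_d => U mu *m Sigma mu in
  let B := ttm (fun mu : 'I_d => invmx (Sigma mu)) C in
  forall mu : 'I_d,
    Y mu = matricize mu X *m kron_other Y mu *m (matricize mu B)^T.
Proof.
move=> C Sigma Y B mu.
have Sigma_unit a : Sigma a \in unitmx := leading_singular_values_unit (hU a) (hr a).
have X_ttm : X = ttm U C.
  rewrite {1}hX; apply: eq_bigr => i _; congr (_ *: _); apply/ffunP => j.
  by rewrite !ffunE; apply: eq_bigr => a _; rewrite colE.
have [UtU /gram_singular_vectors gram _] := hU mu.
have X_rows : (U mu)^T *m matricize mu X = matricize mu C *m (kron_other U mu)^T.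
  by rewrite {1}X_ttm matricize_ttm !mulmxA UtU mul1mx.
have kron_Y_inv : kron_other Y mu *m kron_other (fun a => invmx (Sigma a)) mu
    = kron_other U mu.
  rewrite -kron_otherM; congr castmx; apply: eq_kron_seq => a.
  exact: mulmxK (Sigma_unit a) _.
have gram_rows : matricize mu X *m kron_other U mu *m (matricize mu C)^T
    = U mu *m Sigma mu *m Sigma mu.
  by rewrite -gram -mulmxA -[kron_other U mu]trmxK -trmx_mul -X_rows trmx_mul trmxK.
rewrite matricize_ttm !trmx_mul trmxK trmx_inv tr_diag_mx !mulmxA.
rewrite -[matricize mu X *m _ *m _]mulmxA kron_Y_inv gram_rows.
by rewrite mulmxK.
Qed.
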